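(* Let $\mathcal{H}$ be a complex Hilbert space, let $A\in\mathcal{B}(\mathcal{H})$ be positive semidefinite, let $\mathbb{A}=\begin{pmatrix} A & O \\ O & A \end{pmatrix}$ on $\mathcal{H}\oplus\mathcal{H}$, and let $X,Y\in\mathcal{B}_A(\mathcal{H})$. Then $$dw_{\mathbb{A}}\begin{pmatrix} O & X \\ Y & O \end{pmatrix}\le\sqrt{\tfrac14\|X\|_A^2+\|X\|_A^4}+\sqrt{\tfrac14\|Y\|_A^2+\|Y\|_A^4}.$$
   Context: $\mathcal{B}(\mathcal{H})$ is the algebra of bounded linear operators on the complex Hilbert space $\mathcal{H}$; $O$ is the zero operator. For a positive semidefinite $A\in\mathcal{B}(\mathcal{H})$, put $\langle x,y\rangle_A=\langle Ax,y\rangle$ and $\|x\|_A=\sqrt{\langle x,x\rangle_A}$. $\mathcal{B}_A(\mathcal{H})$ is the set of $T\in\mathcal{B}(\mathcal{H})$ admitting an $A$-adjoint, i.e. such that $AS=T^*A$ for some $S\in\mathcal{B}(\mathcal{H})$; such $T$ are $A$-bounded ($\|Tx\|_A\le c\|x\|_A$ for all $x$ and some $c>0$). For $A$-bounded $T$: $\|T\|_A=\sup\{\|Tx\|_A:\|x\|_A=1\}$ and $dw_A(T)=\sup\{\sqrt{|\langle Tx,x\rangle_A|^2+\|Tx\|_A^4}:\|x\|_A=1\}$, with $x$ ranging over $\mathcal{H}$. The quantity $dw_{\mathbb{A}}$ is defined in the same way for $\mathbb{A}$-bounded operators on the Hilbert space $\mathcal{H}\oplus\mathcal{H}$ with the positive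 operator $\mathbb{A}$ in place of $A$. *)

(* Defs.v *)
From HB Require Import structures.
From mathcomp Require Import all_boot all_order all_algebra.
From mathcomp Require Import complex.
From mathcomp Require Import boolp classical_sets reals topology normedtype.
From mathcomp Require Import ring lra.

Set Implicit Arguments.
Unset Strict Implicit.
Unset Printing Implicit Defensive.

Import Order.TTheory GRing.Theory Num.Theory.
Import numFieldNormedType.Exports.

Local Open Scope classical_set_scope.
Local Open Scope complex_scope.
Local Open Scope ring_scope.

(* The dot product is linear in its first and conjugate-linear in its second
   argument. *)
HB.mixin Record CompleteNormedModule_isHilbert (R : realType) H
    & CompleteNormedModule R[i] H := {
  hdot : {dot H for (@Num.conj R[i])} ;
  sqr_norm_hdot : forall x : H, `|x| ^+ 2 = hdot x x
}.

#[short(type="hilbertType")]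
HB.structure Definition Hilbert (R : realType) :=
  {H of CompleteNormedModule R[i] H & CompleteNormedModule_isHilbert R H}.

(* The orthogonal direct sum of two Hilbert spaces. *)
Definition hsum (R : realType) (H K : hilbertType R) : Type := (H * K)%type.

Section CauchySchwarz.
Variables (C : numClosedFieldType) (U : lmodType C).
Variable f : {dot U for (@Num.conj C)}.

Lemma dot_CauchySchwarz u v : `|f u v| ^+ 2 <= f u u * f v v.
Proof.
have [->|nz_v] := eqVneq v 0.
  by rewrite !linear0r normr0 expr0n mulr0.
pose a := f u v / f v v; pose w := u - a *: v.
have ow : f w v = 0.
  by rewrite /w linearBl /= linearZl_LR /= /a divfK ?dnorm_eq0 ?subrr.
have -> : u = w + a *: v by rewrite /w subrK.
rewrite linearDl /= ow add0r linearZl_LR /= normrM exprMn.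
rewrite (ger0_norm (dnorm_ge0 _ _)).
rewrite hnormDd/=; last by rewrite linearZr_LR/= ow mulr0.
rewrite dnormZ mulrDl -[X in _ + X]mulrA -expr2 lerDr.
by rewrite mulr_ge0 ?dnorm_ge0.
Qed.

Lemma dot_triangle u v :
  sqrtC (f (u + v) (u + v)) <= sqrtC (f u u) + sqrtC (f v v).
Proof.
rewrite -ler_sqr ?nnegrE ?addr_ge0 ?sqrtC_ge0 ?dnorm_ge0//.
rewrite sqrrD !sqrtCK hnormD /= expr0 mul1r [leRHS]addrAC lerD2l.
rewrite -sqrtCM ?nnegrE ?dnorm_ge0//.
have : f u v + (f u v)^* \is Num.real by rewrite CrealE rmorphD /= conjCK addrC.
move=> /real_ler_norm /le_trans; apply.
apply: (le_trans (ler_normD _ _)); rewrite norm_conjC -mulr2n lerMn2r /=.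
rewrite -(@ler_sqr C) ?nnegrE ?sqrtC_ge0 ?mulr_ge0 ?dnorm_ge0// sqrtCK.
exact: dot_CauchySchwarz.
Qed.

End CauchySchwarz.

Section HilbertSum.
Variables (R : realType) (H K : hilbertType R).
Local Notation C := R[i].
Local Notation V := (hsum H K).

HB.instance Definition _ := GRing.Lmodule.copy V (H * K)%type.

Definition hsum_dot (x y : V) : C := hdot x.1 y.1 + hdot x.2 y.2.

Let hsum_dot_bilinear : bilinear_for
  (GRing.Scale.Law.clone _ _ *%R _)
  (GRing.Scale.Law.clone _ _ (Num.conj \; *%R) _) hsum_dot.
Proof.
split=> [y|x] a u v; rewrite /hsum_dot /=.
  by rewrite !linearPl /= mulrDr addrACA.
by rewrite !linearPr /= mulrDr addrACA.
Qed.

HB.instance Definition _ :=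
  bilinear_isBilinear.Build C V V C _ _ hsum_dot hsum_dot_bilinear.


Let hsum_dot_hermitian (x y : V) :
  hsum_dot x y = (-1) ^+ false * (hsum_dot y x)^*%R.
Proof.
rewrite /hsum_dot expr0 mul1r rmorphD /=.
by rewrite (hermC _ x.1) (hermC _ x.2) /= expr0 !mul1r.
Qed.

HB.instance Definition _ := isHermitianSesquilinear.Build C V false
  (@Num.conj C) hsum_dot hsum_dot_hermitian.

Let hsum_dot_gt0 (x : V) : x != 0 -> 0 < hsum_dot x x.
Proof.
move=> x0; rewrite lt_def /hsum_dot addr_ge0 ?dnorm_ge0// andbT.
rewrite paddr_eq0 ?dnorm_ge0// !dnorm_eq0; apply: contra x0.
by case: x => a b /= /andP[/eqP-> /eqP->].
Qed.

HB.instance Definition _ := isDotProduct.Build C V hsum_dot hsum_dot_gt0.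

Definition hsum_norm (x : V) : C := sqrtC (hsum_dot x x).

Let hsum_norm_triangle (x y : V) :
  hsum_norm (x + y) <= hsum_norm x + hsum_norm y.
Proof. exact: (dot_triangle (hsum_dot : {dot V for _})). Qed.

Let hsum_normZ (a : C) (x : V) : hsum_norm (a *: x) = `|a| * hsum_norm x.
Proof.
rewrite /hsum_norm (dnormZ (hsum_dot : {dot V for _})).
by rewrite sqrtCM ?nnegrE ?dnorm_ge0 ?exprn_ge0// sqrCK.
Qed.

Let hsum_norm_eq0 (x : V) : hsum_norm x = 0 -> x = 0.
Proof.
by move/eqP; rewrite sqrtC_eq0 (dnorm_eq0 (hsum_dot : {dot V for _})) => /eqP.
Qed.

HB.instance Definition _ := Lmodule_isNormed.Build C V
  hsum_norm_triangle hsum_normZ hsum_norm_eq0.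

Let hsum_sqr_norm (x : V) : `|x| ^+ 2 = hsum_dot x x.
Proof. by rewrite sqrtCK. Qed.

Lemma hsum_fst_le (x : V) : `|x.1| <= `|x|.
Proof.
rewrite -ler_sqr ?nnegrE// hsum_sqr_norm /hsum_dot -!sqr_norm_hdot.
by rewrite lerDl exprn_ge0.
Qed.

Lemma hsum_snd_le (x : V) : `|x.2| <= `|x|.
Proof.
rewrite -ler_sqr ?nnegrE// hsum_sqr_norm /hsum_dot -!sqr_norm_hdot.
by rewrite lerDr exprn_ge0.
Qed.

Lemma hsum_norm_leD (x : V) : `|x| <= `|x.1| + `|x.2|.
Proof.
rewrite -ler_sqr ?nnegrE ?addr_ge0// hsum_sqr_norm /hsum_dot -!sqr_norm_hdot.
by rewrite sqrrD addrAC lerDl mulrn_wge0 ?mulr_ge0.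
Qed.

Let hsum_complete (F : set_system V) : ProperFilter F -> cauchy F -> cvg F.
Proof.
move=> FF /cauchyP Fc.
have FF1 : ProperFilter (fst @ F : set_system H).
  exact: fmap_proper_filter.
have FF2 : ProperFilter (snd @ F : set_system K).
  exact: fmap_proper_filter.
have cvg1 : cvg (fst @ F : set_system H).
  apply: (@cauchy_cvg H _ FF1); apply/(cauchyP (R := C)) => e e0.
  have [x Fx] := Fc e e0.
  exists x.1; suff : F [set y : V | ball x.1 e y.1] by [].
  apply: filterS Fx => y bxy.
  have xy : `|x - y| < e by move: bxy; rewrite -ball_normE.
  rewrite -ball_normE /=; apply: le_lt_trans xy.
  exact: (hsum_fst_le (x - y)).
have cvg2 : cvg (snd @ F : set_system K).
  apply: (@cauchy_cvg K _ FF2); apply/(cauchyP (R := C)) => e e0.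
  have [x Fx] := Fc e e0.
  exists x.2; suff : F [set y : V | ball x.2 e y.2] by [].
  apply: filterS Fx => y bxy.
  have xy : `|x - y| < e by move: bxy; rewrite -ball_normE.
  rewrite -ball_normE /=; apply: le_lt_trans xy.
  exact: (hsum_snd_le (x - y)).
apply/cvg_ex; 
exists ((lim (fst @ F : set_system H), lim (snd @ F : set_system K)) : V).
apply/fcvgrPdist_lt => e e0; near=> y.
apply: (le_lt_trans (hsum_norm_leD _)); rewrite /= (splitr e) ltrD//.
  by near: y; apply: cvgr_dist_lt => //; rewrite divr_gt0.
by near: y; apply: cvgr_dist_lt => //; rewrite divr_gt0.
Unshelve. all: by end_near. Qed.

HB.instance Definition _ := Uniform_isComplete.Build V hsum_complete.

HB.instance Definition _ :=
  CompleteNormedModule_isHilbert.Build R V hsum_sqr_norm.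

Lemma hdot_hsumE (x y : V) : hdot x y = hdot x.1 y.1 + hdot x.2 y.2.
Proof. by []. Qed.

End HilbertSum.

Section Riesz.
Variables (R : realType) (H : hilbertType R).
Local Notation C := R[i].
Local Notation Re := complex.Re.

Let rdot (x y : H) : R := Re (hdot x y).

Let ReD (a b : C) : Re (a + b) = Re a + Re b. Proof. by case: a b => ? ? []. Qed.
Let ReMr (s : R) (b : C) : Re (s%:C * b) = s * Re b.
Proof. by case: b => ? ? /=; rewrite mul0r subr0. Qed.

Let rdotC x y : rdot x y = rdot y x.
Proof. by rewrite /rdot hermC /= expr0 mul1r; case: (hdot y x). Qed.
Let rdotDl x y z : rdot (x + y) z = rdot x z + rdot y z.
Proof. by rewrite /rdot linearDl /= ReD. Qed.
Let rdotZl (s : R) x z : rdot (s%:C *: x) z = s * rdot x z.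
Proof. by rewrite /rdot linearZl_LR /= ReMr. Qed.
Let rdotDr x y z : rdot z (x + y) = rdot z x + rdot z y.
Proof. by rewrite rdotC rdotDl !(rdotC z). Qed.
Let rdotZr (s : R) x z : rdot z (s%:C *: x) = s * rdot z x.
Proof. by rewrite rdotC rdotZl rdotC. Qed.
Let hdotxx (x : H) : hdot x x = (rdot x x)%:C.
Proof.
rewrite /rdot; have := dnorm_ge0 hdot x; rewrite lecE /=.
by case: (hdot x x) => a b /= /andP[/eqP-> _].
Qed.
Let rdot_ge0 x : 0 <= rdot x x.
Proof. by rewrite -lecR -hdotxx dnorm_ge0. Qed.
Let rdot_CS x y : rdot x y ^+ 2 <= rdot x x * rdot y y.
Proof.
have := dot_CauchySchwarz hdot x y; rewrite !hdotxx -rmorphM /= sqr_normc.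
rewrite /rdot; case: (hdot x y) => a b /=; rewrite lecE /= => /andP[_].
by apply: le_trans; nra.
Qed.

Variable f : H -> C.
Hypothesis fD : forall x y, f (x + y) = f x + f y.
Hypothesis fZ : forall a x, f (a *: x) = a * f x.
Hypothesis f_bounded : exists c : R, forall x, `|f x| <= c%:C * `|x|.

Let rf x : R := Re (f x).
Let rfD x y : rf (x + y) = rf x + rf y. Proof. by rewrite /rf fD ReD. Qed.
Let rfZ (s : R) x : rf (s%:C *: x) = s * rf x.
Proof. by rewrite /rf fZ ReMr. Qed.

Let g x := rdot x x - 2 * rf x.

Let g_lb : has_lbound (range g).
Proof.
have [c fc] := f_bounded; exists (- c ^+ 2) => _ [x _ <-].
rewrite /g.
have h : rf x ^+ 2 <= c ^+ 2 * rdot x x.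
  rewrite -lecR [leRHS]rmorphM /= -hdotxx -sqr_norm_hdot [X in X * _]rmorphXn /= -exprMn.
  have := fc x => /(lerXn2r 2); rewrite !nnegrE normr_ge0.
  move=> /(_ isT (le_trans (normr_ge0 _) (fc x))); apply: le_trans.
  rewrite sqr_normc /rf; case: (f x) => a b /=; rewrite lecE /=.
  by apply/andP; split; [apply/eqP; ring|nra].
have := rdot_ge0 x.
set k := rdot x x in h *; set r := rf x in h *.
move=> k0.
have := sqr_ge0 c; move: h; set d := c ^+ 2 => h d0.
have [|neg] := lerP 0 (k + d - 2 * r); first by lra.
have : (k + d) ^+ 2 < (2 * r) ^+ 2.
  by rewrite ltr_sqr ?nnegrE ?addr_ge0//; lra.
have := sqr_ge0 (k - d); rewrite sqrrB sqrrD exprMn; lra.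
Qed.

Let m := inf (range g).

Let m_le x : m <= g x.
Proof. by apply: ge_inf => //; exists x. Qed.

Let m_adh (e : R) : 0 < e -> exists x, g x < m + e.
Proof.
move=> e0; have [|_ [x _ <-] lt] := @inf_adherent R (range g) e e0.
  by split => //; exists (g 0), 0.
by exists x.
Qed.

Let S (e : R) : set H := [set x | g x < m + e].

Let F : set_system H := filter_from [set e : R | 0 < e] S.

Let FF : ProperFilter F.
Proof.
apply: filter_from_proper; last by move=> e /m_adh.
apply: filter_from_filter; first by exists 1 => /=.
move=> i j /= i0 j0; exists (Num.min i j); first by rewrite /= lt_min i0 j0.
move=> x /= gx; split; apply: (lt_le_trans gx); rewrite lerD2l ge_min lexx ?orbT//.
Qed.

Let normC_lt (x : H) (e : R) : 0 < e -> rdot x x < e ^+ 2 -> `|x| < e%:C.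
Proof.
move=> e0 h; rewrite -ltr_sqr ?nnegrE ?ler0c ?(ltW e0)//.
by rewrite sqr_norm_hdot hdotxx -rmorphXn /= ltcR.
Qed.

Let posC (e : C) : 0 < e -> exists2 r : R, 0 < r & e = r%:C.
Proof.
by case: e => a b; rewrite ltcE /= => /andP[/eqP-> a0]; exists a.
Qed.

Let parallelogram x y e : S e x -> S e y -> rdot (x - y) (x - y) < 4 * e.
Proof.
rewrite /S /= => gx gy.
have := m_le (2^-1%:C *: (x + y)); rewrite /g.
rewrite rdotZl rdotZr rfZ rfD !rdotDl !rdotDr (rdotC y x).
rewrite /g in gx gy.
have -> : - y = (-1)%:C *: y by rewrite rmorphN1 scaleN1r.
rewrite !rdotZl !rdotZr (rdotC y x).
lra.
Qed.

Let Fcvg : cvg F.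
Proof.
apply: (@cauchy_cvg H _ FF); apply/(@cauchyP C H F FF) => e /posC[r r0 ->].
have e0 : 0 < r ^+ 2 / 4 by rewrite divr_gt0 ?exprn_gt0.
have [x xS] := m_adh e0.
exists x; exists (r ^+ 2 / 4) => //= y yS.
rewrite -ball_normE /=; apply: normC_lt => //.
by have := parallelogram xS yS; lra.
Qed.

Let variation x h e : 0 < e -> S e x ->
  (rdot x h - rf h) ^+ 2 <= e * (rdot h h + 1).
Proof.
move=> e0; rewrite /S /= => xS; set b := rdot x h - rf h.
have k0 := rdot_ge0 h.
have := m_le (x + (- (b / (rdot h h + 1)))%:C *: h).
rewrite /g rfD rfZ !rdotDl !rdotDr !rdotZl !rdotZr (rdotC h x).
move: xS; rewrite /g; set k := rdot h h in k0 *.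
set s := b / (k + 1) => xS ineq.
have bE : b = s * (k + 1) by rewrite /s divfK// gt_eqF// ltr_wpDl.
have : - s * (2 * b) + s ^+ 2 * k + e >= 0 by rewrite /b; nra.
rewrite bE => h1.
have h2 : s ^+ 2 * (k + 2) <= e by nra.
have h3 : s ^+ 2 * (k + 1) <= e by nra.
have -> : (s * (k + 1)) ^+ 2 = (s ^+ 2 * (k + 1)) * (k + 1) by ring.
by apply: ler_wpM2r => //; lra.
Qed.

Let riesz_re : exists z, forall h, rf h = rdot h z.
Proof.
exists (lim F) => h; rewrite rdotC; apply/eqP; rewrite eq_sym -subr_eq0.
have PF : ProperFilter F := FF.
set z := lim F; set B := rdot z h - rf h.
apply/negP => /negP B0.
have k0 := rdot_ge0 h; set k := rdot h h in k0 *.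
have B2 : 0 < B ^+ 2 by rewrite exprn_even_gt0.
pose e := B ^+ 2 / (4 * (2 * k + 1)).
have e0 : 0 < e by rewrite divr_gt0// mulr_gt0//; lra.
have se0 : 0 < Num.sqrt e by rewrite sqrtr_gt0.
have [x [xS xz]] : exists x, S e x /\ rdot (z - x) (z - x) < e.
  have F1 : F (S e) by exists e.
  have F2 : \forall x \near F, `|z - x| < (Num.sqrt e)%:C.
    have /fcvgrPdist_lt : F --> z := Fcvg.
    by apply; rewrite ltcR.
  near F => x; exists x; split; first by near: x.
  have : `|z - x| < (Num.sqrt e)%:C by near: x.
  rewrite -ltr_sqr ?nnegrE ?ler0c ?sqrtr_ge0//.
  rewrite sqr_norm_hdot hdotxx -rmorphXn /= ltcR sqr_sqrtr//.
  exact: ltW.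
have h1 := variation h e0 xS.
have h2 := rdot_CS (z - x) h.
have BE : B = (rdot x h - rf h) + rdot (z - x) h.
  have zE : rdot z h = rdot (z - x) h + rdot x h by rewrite -rdotDl subrK.
  by rewrite /B zE; ring.
have eE : e * (4 * (2 * k + 1)) = B ^+ 2.
  by rewrite /e divfK// mulf_neq0// gt_eqF//; lra.
rewrite -/k in h1 h2.
move: h1 h2 BE; set b := rdot x h - rf h; set d := rdot (z - x) h => h1 h2 BE.
have h3 : rdot (z - x) (z - x) * k <= e * k.
  by apply: ler_wpM2r => //; exact: ltW.
have h4 : B ^+ 2 <= 2 * b ^+ 2 + 2 * d ^+ 2.
  rewrite BE; have := sqr_ge0 (b - d); nra.
have h5 : e * k >= 0 by rewrite mulr_ge0 ?(ltW e0).
lra.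
Unshelve. all: by end_near. Qed.

Lemma riesz : exists z, forall h, f h = hdot h z.
Proof.
have [z fz] := riesz_re; exists z => h.
have := fz h; have := fz ('i *: h).
rewrite /rf /rdot fZ linearZl_LR /=.
case: (f h) (hdot h z) => a b [c d] /=.
by rewrite !mul0r !mul1r !sub0r => /oppr_inj-> ->.
Qed.

End Riesz.

Section Operators.
Variable R : realType.
Implicit Types H K : hilbertType R.

Definition bounded_op H K (T : H -> K) :=
  exists c : R, forall x, `|T x| <= c%:C * `|x|.

Definition psd_op H (A : H -> H) := forall x, 0 <= hdot (A x) x.

(* For a bounded linear T, the set below is a singleton by the Riesz
   representation theorem: see [adjointP]. *)
Definition adjoint H K (T : H -> K) (y : K) : H :=
  xget 0 [set z | forall x, hdot (T x) y = hdot x z].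

Lemma adjointP H K (T : {linear H -> K}) (x : H) (y : K) :
  bounded_op T -> hdot (T x) y = hdot x (adjoint T y).
Proof.
move=> [c Tc].
suff ex : exists z, forall u, hdot (T u) y = hdot u z.
  exact: (@xgetPex _ 0 [set z | forall u, hdot (T u) y = hdot u z] ex).
apply: (@riesz R H (fun u => hdot (T u) y)) => [u v|a u|].
    by rewrite linearD linearDl.
  by rewrite linearZ linearZl_LR.
exists (c * complex.Re `|y|) => u.
have yE : (complex.Re `|y|)%:C = `|y| by rewrite RRe_real ?normr_real.
rewrite [X in X * _]rmorphM /= yE mulrAC.
apply: (@le_trans _ _ (`|T u| * `|y|)); last by rewrite ler_wpM2r.
rewrite -ler_sqr ?nnegrE ?mulr_ge0// exprMn !sqr_norm_hdot.
exact: dot_CauchySchwarz.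
Qed.

(* The operator matrix with rows (T11, T12) and (T21, T22). *)
Definition opmx H K (T11 : {linear H -> H}) (T12 : {linear K -> H})
    (T21 : {linear H -> K}) (T22 : {linear K -> K}) (x : hsum H K) : hsum H K :=
  (T11 x.1 + T12 x.2, T21 x.1 + T22 x.2).

Section OperatorMatrix.
Variables (H K : hilbertType R) (T11 : {linear H -> H}) (T12 : {linear K -> H}).
Variables (T21 : {linear H -> K}) (T22 : {linear K -> K}).

Let opmx_linear : linear (opmx T11 T12 T21 T22).
Proof.
move=> a x y; congr pair => /=.
  by rewrite !linearP scalerDr addrACA.
by rewrite !linearP scalerDr addrACA.
Qed.

HB.instance Definition _ := GRing.isLinear.Build R[i] (hsum H K) (hsum H K) _
  (opmx T11 T12 T21 T22) opmx_linear.

Lemma bounded_opmx : bounded_op T11 -> bounded_op T12 ->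
  bounded_op T21 -> bounded_op T22 -> bounded_op (opmx T11 T12 T21 T22).
Proof.
have le_c (U V W : hilbertType R) (T : U -> V) (p : W -> U) c (x : W) :
    (forall u, `|T u| <= c%:C * `|u|) -> `|p x| <= `|x| ->
    `|T (p x)| <= `|c|%:C * `|x|.
  move=> Tc px; apply: (le_trans (Tc _)).
  apply: (@le_trans _ _ (`|c|%:C * `|p x|)).
    by rewrite ler_wpM2r// lecR ler_norm.
  by rewrite ler_wpM2l// ler0c.
move=> [a Ha] [b Hb] [c Hc] [d Hd].
exists ((`|a| + `|b|) + (`|c| + `|d|)) => x.
apply: (le_trans (hsum_norm_leD _)); rewrite /= !rmorphD /= 3!mulrDl.
by apply: lerD; apply: (le_trans (ler_normD _ _)); apply: lerD;
  apply: (le_c _ _ (hsum H K)) => //;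
  [exact: hsum_fst_le|exact: hsum_snd_le|exact: hsum_fst_le|exact: hsum_snd_le].
Qed.

Lemma psd_opmx_diag : psd_op T11 -> psd_op T22 -> psd_op (opmx T11 \0 \0 T22).
Proof. by move=> p1 p2 x; rewrite hdot_hsumE /= addr0 add0r addr_ge0. Qed.

End OperatorMatrix.

Section SemiInner.
Variable H : hilbertType R.
Implicit Types A T : H -> H.

Definition adot A (x y : H) : R[i] := hdot (A x) y.

Definition anorm A (x : H) : R := Num.sqrt (complex.Re (adot A x x)).

(* For T in B(H), membership of T in B_A(H). *)
Definition has_Aadjoint A T :=
  exists2 S : {linear H -> H}, bounded_op S & A \o S =1 adjoint T \o A.

(* [sup] is real-valued with [sup set0 = 0]; the sets below are empty only
   when A = 0, and bounded as soon as T is A-bounded. *)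
Definition aopnorm A T : R :=
  sup [set anorm A (T x) | x in [set x | anorm A x = 1]].

Definition dwradius A T : R :=
  sup [set Num.sqrt (complex.Re `|adot A (T x) x| ^+ 2 + anorm A (T x) ^+ 4)
      | x in [set x | anorm A x = 1]].

End SemiInner.

End Operators.

(* Main.v *)
(* For z = (x, y) with ||x||_A^2 + ||y||_A^2 = 1 and T = [[0, X], [Y, 0]],
   |<Tz, z>| <= (||X||_A + ||Y||_A) ||x||_A ||y||_A <= (||X||_A + ||Y||_A) / 2
   and ||Tz||^2 <= ||X||_A^2 + ||Y||_A^2, so the Euclidean norm of the pair
   (|<Tz, z>|, ||Tz||^2) is at most the sum of those of (||X||_A / 2, ||X||_A^2)
   and (||Y||_A / 2, ||Y||_A^2).  The suprema defining ||X||_A and ||Y||_A are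
   genuine because an A-adjoint S of X makes X A-bounded: S X is symmetric for
   <., .>_A, hence A-bounded, and ||X x||_A^2 = <S X x, x>_A. *)
Require Import Defs.
From HB Require Import structures.
From mathcomp Require Import all_boot all_order all_algebra.
From mathcomp Require Import complex.
From mathcomp Require Import boolp classical_sets reals topology normedtype.
From mathcomp Require Import ring lra.

Import Order.TTheory GRing.Theory Num.Theory.
Import numFieldNormedType.Exports.
Local Open Scope ring_scope.

(** * The semi-inner product induced by a positive operator *)

Section SemiInnerProduct.
Context {R : realType} {H : hilbertType R}.
Local Notation Re := (@complex.Re R).
Local Open Scope complex_scope.

Lemma adotDl (A : {linear H -> H}) x y z :
  adot A (x + y) z = adot A x z + adot A y z.
Proof. by rewrite /adot linearD linearDl. Qed.

Lemma adotDr (A : H -> H) x y z : adot A x (y + z) = adot A x y + adot A x z.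
Proof. by rewrite /adot linearDr. Qed.

Lemma adotZl (A : {linear H -> H}) a x y : adot A (a *: x) y = a * adot A x y.
Proof. by rewrite /adot linearZ linearZl_LR. Qed.

Lemma adotZr (A : H -> H) a x y : adot A x (a *: y) = a^* * adot A x y.
Proof. by rewrite /adot linearZr_LR. Qed.

Lemma hdotC (x y : H) : hdot x y = (hdot y x)^*.
Proof. by rewrite hermC /= expr0 mul1r. Qed.

Lemma ge0_Im (z : R[i]) : 0 <= z -> complex.Im z = 0.
Proof. by case: z => a b; rewrite lecE /= => /andP[/eqP]. Qed.

(** Positivity makes every [adot A z z] real. By polarization, [z = x + y] settles the imaginary
    parts and [z = x + 'i *: y] the real parts. *)
Lemma adotC {A : {linear H -> H}} (A_psd : psd_op A) x y :
  adot A x y = (adot A y x)^*.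
Proof.
have := ge0_Im _ (A_psd (x + y)); have := ge0_Im _ (A_psd (x + 'i *: y)).
have := ge0_Im _ (A_psd x); have := ge0_Im _ (A_psd y).
rewrite -!/(adot A _ _) !(adotDl, adotDr, adotZl, adotZr).
case: (adot A x x) (adot A y y) (adot A x y) (adot A y x).
move=> a1 b1 [a2 b2] [a3 b3] [a4 b4] /= h1 h2 h3 h4.
by congr Complex; lra.
Qed.

Lemma sqr_anorm {A : H -> H} (A_psd : psd_op A) x :
  (anorm A x ^+ 2)%:C = adot A x x.
Proof.
have := A_psd x; rewrite -/(adot A x x) /anorm.
case: (adot A x x) => a b; rewrite lecE /= => /andP[/eqP-> a0].
by rewrite sqr_sqrtr.
Qed.

Lemma anorm_ge0 (A : H -> H) x : 0 <= anorm A x.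
Proof. exact: sqrtr_ge0. Qed.

Lemma Re_norm_ge0 {V : normedZmodType R[i]} (v : V) : 0 <= Re `|v|.
Proof. by rewrite -lecR RRe_real ?normr_real ?normr_ge0. Qed.

Lemma Re_norm_leD {V : normedZmodType R[i]} (u v : V) :
  Re `|u + v| <= Re `|u| + Re `|v|.
Proof. by rewrite -lecR rmorphD /= !RRe_real ?normr_real ?ler_normD. Qed.

Lemma sqr_Re_norm (z : R[i]) : Re `|z| ^+ 2 = Re z ^+ 2 + complex.Im z ^+ 2.
Proof.
by case: z => a b; rewrite normc_def /= sqr_sqrtr // addr_ge0 ?sqr_ge0.
Qed.

Lemma adot_CauchySchwarz {A : {linear H -> H}} (A_psd : psd_op A) x y :
  Re `|adot A x y| <= anorm A x * anorm A y.
Proof.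
rewrite -ler_sqr ?nnegrE ?mulr_ge0 ?anorm_ge0 ?Re_norm_ge0 // exprMn.
set a := anorm A x ^+ 2; set d := anorm A y ^+ 2; set b := Re _ ^+ 2.
have a0 : 0 <= a by exact: sqr_ge0.
have d0 : 0 <= d by exact: sqr_ge0.
have b0 : 0 <= b by exact: sqr_ge0.
(* This is the squared A-norm of [s x - t <x,y>_A y]; the factor [<x,y>_A] turns both cross terms
   into real multiples of [b]. *)
have q (s t : R) : 0 <= s ^+ 2 * a - 2 * s * t * b + t ^+ 2 * b * d.
  have := A_psd (s%:C *: x + (- t%:C * adot A x y) *: y).
  rewrite -/(adot A _ _) !(adotDl, adotDr, adotZl, adotZr).
  rewrite -!sqr_anorm // (adotC A_psd y x) /b sqr_Re_norm -/a -/d.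
  case: (adot A x y) => u v /=; rewrite lecE /= => /andP[_].
  by congr (_ <= _); ring.
have [dp|] := ltrP 0 d; first by have := q d 1; nra.
move=> dn; have -> : d = 0 by lra.
rewrite mulr0 leNgt; apply/negP => bp.
(* For a null vector [y] the form [q 1 t] is affine in [t], and this [t] gives it the value
   [- a - 2 < 0]. *)
have bV : (a + 1) / b * b = a + 1 by rewrite divfK // gt_eqF.
have := q 1 ((a + 1) / b); have -> : d = 0 by lra.
by rewrite -[X in _ - X]mulrA bV; lra.
Qed.

Lemma anorm_scale {A : {linear H -> H}} (A_psd : psd_op A) (s : R) x :
  0 <= s -> anorm A (s%:C *: x) = s * anorm A x.
Proof.
move=> s0; apply/eqP; rewrite -(@eqrXn2 _ 2) ?mulr_ge0 ?anorm_ge0 //.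
apply/eqP; apply: (@complexI R).
rewrite sqr_anorm // adotZl adotZr exprMn rmorphM /= sqr_anorm //.
rewrite expr2 rmorphM /= -mulrA; congr (_ * (_ * _)).
exact: conjc_real.
Qed.

(** * A-boundedness of operators *)

Lemma anorm_bounded {A : {linear H -> H}} : psd_op A -> bounded_op A ->
  exists2 k, 0 <= k & forall x, anorm A x <= k * Re `|x|.
Proof.
move=> A_psd [c Ac]; exists (Num.sqrt `|c|) => [|x]; first exact: sqrtr_ge0.
rewrite -ler_sqr ?nnegrE ?mulr_ge0 ?anorm_ge0 ?sqrtr_ge0 ?Re_norm_ge0 //.
rewrite exprMn (@sqr_sqrtr _ `|c|) // -lecR sqr_anorm // rmorphM rmorphXn /=.
rewrite RRe_real ?normr_real //.
have le1 : `|adot A x x| <= `|A x| * `|x|.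
  rewrite -ler_sqr ?nnegrE ?mulr_ge0 // exprMn !sqr_norm_hdot.
  exact: dot_CauchySchwarz.
rewrite -(ger0_norm (A_psd x : 0 <= adot A x x)).
apply: (le_trans le1); rewrite expr2 mulrA ler_wpM2r //.
by apply: (le_trans (Ac x)); rewrite ler_wpM2r // lecR ler_norm.
Qed.

(* The A-norms u_n of W^n x satisfy u_n^2 <= u_2n u_0, so u_1 > w u_0 would
   force u_(2^n) to outgrow the bound u_m <= const * w^m. *)
Lemma Asym_Abounded {A : {linear H -> H}} (W : H -> H) :
  psd_op A -> bounded_op A -> bounded_op W ->
  (forall x y, adot A (W x) y = adot A x (W y)) ->
  exists2 w, 0 <= w & forall x, anorm A (W x) <= w * anorm A x.
Proof.
move=> A_psd A_bd [c Wc] W_sym; have [k k0 Ak] := anorm_bounded A_psd A_bd.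
pose w := `|c| + 1; have w0 : 0 < w by rewrite ltr_wpDl.
exists w => [|x]; first exact: ltW.
pose u n := anorm A (iter n W x).
have u_ge0 n : 0 <= u n by exact: anorm_ge0.
have W_iter n y z : adot A (iter n W y) z = adot A y (iter n W z).
  by elim: n y z => [|n IH] y z //=; rewrite W_sym IH -iterSr.
have u_sqr n : u n ^+ 2 <= u (n + n)%N * u 0%N.
  rewrite mulrC; apply: le_trans (adot_CauchySchwarz A_psd x _).
  rewrite iterD -W_iter -(@sqr_anorm A) //.
  by rewrite ger0_norm ?ler0c ?sqr_ge0.
have u_le n : u n <= k * Re `|x| * w ^+ n.
  apply: (le_trans (Ak _)); rewrite -mulrA ler_wpM2l //.
  elim: n => [|n IH] /=; first by rewrite mulr1.
  apply: (@le_trans _ _ (w * Re `|iter n W x|)); last first.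
    by rewrite exprS mulrCA ler_wpM2l // ltW.
  rewrite -lecR rmorphM /= !RRe_real ?normr_real //.
  apply: (le_trans (Wc _)); rewrite ler_wpM2r // lecR.
  by rewrite (le_trans (ler_norm _)) // lerDl.
rewrite -[anorm A (W x)]/(u 1%N) -[anorm A x]/(u 0%N).
have [u00|u00] := eqVneq (u 0%N) 0.
  by have := u_sqr 1%N; rewrite u00 !mulr0; nra.
rewrite leNgt; apply/negP => u1.
have up : 0 < u 0%N by rewrite lt_def u00 u_ge0.
(* The relative excess of [u 1%N] over [w * u 0%N], positive under the assumption to be refuted. *)
pose d := u 1%N / (w * u 0%N) - 1.
have d0 : 0 < d by rewrite subr_gt0 ltr_pdivlMr ?mul1r ?mulr_gt0.
have u1E : u 1%N = (1 + d) * w * u 0%N.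
  by rewrite addrC subrK -mulrA divfK // mulf_neq0 // gt_eqF.
have dw0 : 0 <= (1 + d) * w by nra.
(* Doubling the index with [u_sqr] squares the lower bound on the ratio to [u 0%N]. *)
have pow n : ((1 + d) * w) ^+ (2 ^ n) * u 0%N <= u (2 ^ n)%N.
  elim: n => [|n IH]; first by rewrite u1E.
  rewrite -(ler_pM2r up) expnS mul2n -addnn.
  apply: le_trans (u_sqr _).
  rewrite exprD -expr2 -mulrA -expr2 -exprMn ler_sqr ?nnegrE ?u_ge0 //.
  by rewrite mulr_ge0 ?exprn_ge0.
(* Bernoulli's inequality: the powers of [1 + d] exceed any bound, whereas [u_le] caps them once
   [w ^+ (2 ^ n)] is cancelled. *)
have lin n : 1 + n%:R * d <= (1 + d) ^+ n.
  elim: n => [|n IH]; first by rewrite mul0r addr0.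
  rewrite exprS; have : 0 <= n%:R :> R by []; nra.
pose b := k * Re `|x| / u 0%N / d.
have [n bn] : exists n : nat, b < n%:R.
  by exists (Num.truncn b).+1; exact: Num.Theory.truncnS_gt.
have : (1 + d) ^+ (2 ^ n) * u 0%N <= k * Re `|x|.
  have wn : 0 < w ^+ (2 ^ n) by rewrite exprn_gt0.
  rewrite -(ler_pM2r wn) mulrAC -exprMn.
  exact: le_trans (pow n) (u_le _).
rewrite -ler_pdivlMr // leNgt => /negP; apply.
apply: lt_le_trans (lin _).
have : k * Re `|x| / u 0%N < n%:R * d by rewrite -ltr_pdivrMr.
have : n%:R <= (2 ^ n)%:R :> R by rewrite ler_nat ltnW // ltn_expl.
nra.
Qed.

Lemma Aadjoint_Abounded {A X : {linear H -> H}} :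
  psd_op A -> bounded_op A -> bounded_op X -> has_Aadjoint A X ->
  exists2 w, 0 <= w & forall x, anorm A (X x) <= w * anorm A x.
Proof.
move=> A_psd A_bd X_bd [S S_bd SA].
have WE x y : adot A (S (X x)) y = adot A (X x) (X y).
  rewrite /adot; have /= -> := SA (X x).
  by rewrite hdotC -adjointP // -hdotC.
have W_sym x y : adot A (S (X x)) y = adot A x (S (X y)).
  by rewrite WE (adotC A_psd) -WE -adotC.
have W_bd : bounded_op (S \o X).
  case: X_bd S_bd => [c Xc] [d Sd]; exists (`|d| * c) => x.
  apply: (le_trans (Sd _)); rewrite rmorphM -mulrA /=.
  apply: (@le_trans _ _ (`|d|%:C * `|X x|)).
    by rewrite ler_wpM2r // lecR ler_norm.
  by rewrite ler_wpM2l // ler0c.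
have [w w0 Ww] := Asym_Abounded _ A_psd A_bd W_bd W_sym.
(* The root appears because Cauchy-Schwarz bounds the square:
   [||Xx||_A^2 = <SXx,x>_A <= w ||x||_A^2]. *)
exists (Num.sqrt w) => [|x]; first exact: sqrtr_ge0.
rewrite -ler_sqr ?nnegrE ?mulr_ge0 ?anorm_ge0 ?sqrtr_ge0 //.
rewrite exprMn (@sqr_sqrtr _ w) //.
apply: (@le_trans _ _ (anorm A (S (X x)) * anorm A x)).
  apply: le_trans (adot_CauchySchwarz A_psd _ _).
  by rewrite WE -sqr_anorm // ger0_norm ?ler0c ?sqr_ge0.
by rewrite expr2 mulrA ler_wpM2r ?anorm_ge0 ?Ww.
Qed.

(** * The A-operator seminorm *)

Lemma anorm_le_aopnorm {A X : {linear H -> H}} x :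
  psd_op A -> bounded_op A -> bounded_op X -> has_Aadjoint A X ->
  anorm A (X x) <= aopnorm A X * anorm A x.
Proof.
move=> A_psd A_bd X_bd X_adj.
have [w w0 Xw] := Aadjoint_Abounded A_psd A_bd X_bd X_adj.
(* Null vectors cannot be normalized; A-boundedness shows that [X] maps them to null vectors. *)
have [x0|x0] := eqVneq (anorm A x) 0.
  by have := Xw x; rewrite x0 !mulr0.
have xp : 0 < anorm A x by rewrite lt_def x0 anorm_ge0.
rewrite -ler_pdivrMr // mulrC -(anorm_scale A_psd) ?invr_ge0 ?anorm_ge0 //.
rewrite -linearZ; apply: ub_le_sup.
  exists w => _ [y /= y1 <-].
  by apply: (le_trans (Xw y)); rewrite y1 mulr1.
exists ((anorm A x)^-1%:C *: x) => //=.
by rewrite anorm_scale ?invr_ge0 ?anorm_ge0 // mulVf.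
Qed.

Lemma aopnorm_ge0 (A X : H -> H) : 0 <= aopnorm A X.
Proof.
rewrite /aopnorm; set S := [set _ | _ in _]%classic.
(* An empty or unbounded set has the default supremum 0. *)
have [S_sup|/sup_out->//] := pselect (has_sup S).
have [[s Ss] S_ub] := S_sup; have [y _ sE] := Ss.
by apply: le_trans (ub_le_sup S_ub Ss); rewrite -sE anorm_ge0.
Qed.

End SemiInnerProduct.

(** * The bound on the Davis-Wielandt radius *)

Lemma sqrt_sqrD_triangle {R : rcfType} (a b c d : R) :
  Num.sqrt ((a + c) ^+ 2 + (b + d) ^+ 2) <=
  Num.sqrt (a ^+ 2 + b ^+ 2) + Num.sqrt (c ^+ 2 + d ^+ 2).
Proof.
have p0 : 0 <= a ^+ 2 + b ^+ 2 by rewrite addr_ge0 ?sqr_ge0.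
have r0 : 0 <= (a + c) ^+ 2 + (b + d) ^+ 2 by rewrite addr_ge0 ?sqr_ge0.
have q0 : 0 <= c ^+ 2 + d ^+ 2 by rewrite addr_ge0 ?sqr_ge0.
rewrite -ler_sqr ?nnegrE ?addr_ge0 ?sqrtr_ge0 // [leRHS]sqrrD !sqr_sqrtr //.
rewrite -sqrtrM //.
(* Planar Cauchy-Schwarz, whose defect is [(a * d - b * c) ^+ 2] by Lagrange's identity. *)
suff : a * c + b * d <= Num.sqrt ((a ^+ 2 + b ^+ 2) * (c ^+ 2 + d ^+ 2)) by lra.
apply: (le_trans (ler_norm _)); rewrite -sqrtr_sqr ler_wsqrtr //.
by have := sqr_ge0 (a * d - b * c); nra.
Qed.

Theorem corollary2p26 (R : realType) (H : hilbertType R)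
    (A X Y : {linear H -> H})
    (A_bounded : bounded_op A) (A_psd : psd_op A)
    (X_bounded : bounded_op X) (X_adj : has_Aadjoint A X)
    (Y_bounded : bounded_op Y) (Y_adj : has_Aadjoint A Y) :
  dwradius (opmx A \0 \0 A) (opmx \0 X Y \0) <=
  Num.sqrt (4^-1 * aopnorm A X ^+ 2 + aopnorm A X ^+ 4) +
  Num.sqrt (4^-1 * aopnorm A Y ^+ 2 + aopnorm A Y ^+ 4).
Proof.
have dotE (u v : hsum H H) :
    adot (opmx A \0 \0 A) u v = adot A u.1 v.1 + adot A u.2 v.2.
  by rewrite /adot hdot_hsumE /= addr0 add0r.
have normE (u : hsum H H) :
    anorm (opmx A \0 \0 A) u ^+ 2 = anorm A u.1 ^+ 2 + anorm A u.2 ^+ 2.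
  apply: (@complexI R); rewrite rmorphD /= !sqr_anorm ?dotE //.
  exact: psd_opmx_diag.
rewrite /dwradius; set S := [set _ | _ in _]%classic.
(* With no vector of unit A-norm, the supremum is 0 by convention. *)
have [S0|/set0P [s Ss]] := eqVneq S set0.
  by rewrite S0 sup0 addr_ge0 ?sqrtr_ge0.
apply: ge_sup; first by exists s.
move=> _ [[x y] xy1 <-]; rewrite /= in xy1.
have Xy := anorm_le_aopnorm y A_psd A_bounded X_bounded X_adj.
have Yx := anorm_le_aopnorm x A_psd A_bounded Y_bounded Y_adj.
have := normE (x, y); rewrite xy1 expr1n /= => xy.
have := normE (opmx \0 X Y \0 ((x, y) : hsum H H)).
rewrite /= add0r addr0 => TE.
have dE := dotE (opmx \0 X Y \0 ((x, y) : hsum H H)) (x, y).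
rewrite /= add0r addr0 in dE.
have p0 := aopnorm_ge0 A X; have q0 := aopnorm_ge0 A Y.
set p := aopnorm A X in p0 Xy *; set q := aopnorm A Y in q0 Yx *.
have Tdot : complex.Re `|adot (opmx A \0 \0 A)
    (opmx \0 X Y \0 ((x, y) : hsum H H)) (x, y)| <=
    complex.Re `|adot A (X y) x| + complex.Re `|adot A (Y x) y|.
  by rewrite dE; exact: Re_norm_leD.
have {Tdot} := le_trans Tdot (lerD (adot_CauchySchwarz A_psd (X y) x)
  (adot_CauchySchwarz A_psd (Y x) y)).
move: TE (Re_norm_ge0 (adot (opmx A \0 \0 A)
  (opmx \0 X Y \0 ((x, y) : hsum H H)) (x, y))).
set t := complex.Re _; set n := anorm _ (opmx _ _ _ _ _) => nE t0 tle.
move: (anorm_ge0 A x) (anorm_ge0 A y) (anorm_ge0 A (X y)) (anorm_ge0 A (Y x)).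
move: Xy Yx xy nE tle.
set a := anorm A x; set b := anorm A y.
set v := anorm A (X y); set w := anorm A (Y x) => vb wa ab nE tle a0 b0 v0 w0.
(* The unit constraint [ab] gives [a ^+ 2 + b ^+ 2 = 1]; the resulting 1/2 is the source of the 1/4
   in the bound. *)
have ab2 : a * b <= 2^-1 by have := sqr_ge0 (a - b); lra.
have tle' : t <= p / 2 + q / 2 by nra.
have v2 : v ^+ 2 <= p ^+ 2 by nra.
have w2 : w ^+ 2 <= q ^+ 2 by nra.
have nle : n ^+ 2 <= p ^+ 2 + q ^+ 2 by lra.
have n2 := sqr_ge0 n.
apply: (@le_trans _ _
    (Num.sqrt ((p / 2 + q / 2) ^+ 2 + (p ^+ 2 + q ^+ 2) ^+ 2))).
  rewrite ler_wsqrtr // (exprM n 2 2) lerD // ler_sqr ?nnegrE //; lra.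
(* Each radicand becomes the squared length of [(r / 2, r ^+ 2)], ready for the planar triangle
   inequality. *)
have sqE (r : R) : 4^-1 * r ^+ 2 + r ^+ 4 = (r / 2) ^+ 2 + (r ^+ 2) ^+ 2.
  by field.
by rewrite !sqE; exact: sqrt_sqrD_triangle.
Qed.
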